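(* Let $A,B,C,D,W,X,Y,Z$ be subspaces of a finite-dimensional vector space $V$ whose scalar field is finite and of characteristic $3$. Then \begin{align*} H(A) \le\ & 9H(Z) + 8H(Y) + 5H(X) + 6H(W) - 4H(D) - 12H(C) - 11H(B) - H(A)\\ & + 19H(Z|A,B,C) + 17H(Y|A,B,D) + 13H(X|A,C,D) + 11H(W|B,C,D)\\ & + H(A|W,X,Y,Z) + H(A|B,W,X) + 7H(B|D,X,Z) + 4H(B|C,X,Y)\\ & + 7H(C|D,Y,Z) + 5H(C|A,W,Y) + 4H(D|A,W,Z)\\ & + 29\bigl(H(A) + H(B) + H(C) + H(D) - H(A,B,C,D)\bigr). \end{align*} (That is, this is a linear rank inequality over $V$.)
   Context: For subspaces of a finite-dimensional vector space $V$, $H(S)$ denotes the dimension (rank) of the subspace $S$; $H(S_1,\dots,S_m)$ denotes the dimension of the span of $S_1\cup\dots\cup S_m$; and $H(S|T_1,\dots,T_m) = H(S,T_1,\dots,T_m) - H(T_1,\dots,T_m)$. A linear rank inequality over $V$ is a linear inequality among such quantities that is satisfied by every assignment of subspaces of $V$ to the variables. *)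

(* Defs.v *)
From HB Require Import structures.
From mathcomp Require Import all_boot all_order all_algebra.

Set Implicit Arguments.
Unset Strict Implicit.
Unset Printing Implicit Defensive.

Import GRing.Theory.
Local Open Scope ring_scope.

(* Ranks are taken in int, so that the subtractions are not truncated.
   The joint rank H(S_1, ..., S_m) is H of the sum of subspaces
   (S_1 + ... + S_m)%VS, i.e. of the span of their union. *)
Definition H (F : fieldType) (V : vectType F) (S : {vspace V}) : int :=
  (\dim S)%:Z.

(* H(S | T_1, ..., T_m), with T := (T_1 + ... + T_m)%VS. *)
Definition Hcond (F : fieldType) (V : vectType F) (S T : {vspace V}) : int :=
  H (S + T)%VS - H T.

(* Main.v *)
(**
  Write every vector of Z in A + B + C as a sum of components in A, B and C, and
  similarly for W, X, Y. When A, B, C, D are independent, each hypothesis such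
  as "B lies in D + X + Z" says that X and Z have proportional A- and
  C-components, and that the B-component is injective on the relevant part of
  Z; in general this holds on subspaces of controlled codimension. Take a in A
  in the span of W, X, Y, Z, so a = w + x + y + z. On a subspace of A whose
  codimension is at most the sum of the errors, the proportionalities and
  characteristic 3 make the A-components of x, y and z coincide, so that a is
  three times a vector, hence zero. The subspace thus vanishes, so H(A) is at
  most its codimension; this bound is even smaller than the required one, the
  difference being a sum of trivial inequalities such as H(Z1) <= H(Z).
*)

Require Import Defs.
From mathcomp Require Import all_boot all_order all_algebra.
From mathcomp Require Import zify.
Import Order.TTheory GRing.Theory Num.Theory.
Local Open Scope ring_scope.

(** * Dimension counts for images, preimages and intersections *)

Lemma dim_limg_inj {F : fieldType} {U V : vectType F} (f : 'Hom(U, V))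
    (S : {vspace U}) :
  (forall v, v \in S -> f v = 0 -> v = 0) -> \dim (f @: S) = \dim S.
Proof.
move=> finj; apply: limg_dim_eq; apply/eqP; rewrite -subv0.
apply/subvP=> v; rewrite memv_cap memv_ker memv0.
by move=> /andP[/finj vS /eqP/vS ->].
Qed.

(** For [S'] the preimage of [T'] in [S], [f] induces an injection of [S / S'] into [T / T']. Each
    restriction to a smaller subspace below is paid for at this price. *)
Lemma cut_preimage {F : fieldType} {U V : vectType F} (f : 'Hom(U, V))
    (S : {vspace U}) {T T' : {vspace V}} :
    (T' <= T)%VS -> (forall v, v \in S -> f v \in T) ->
  exists2 S' : {vspace U}, forall v, v \in S' -> v \in S /\ f v \in T'
            & (\dim S + \dim T' <= \dim S' + \dim T)%N.
Proof.
move=> sT'T fST; exists (S :&: f @^-1: T')%VS.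
  by move=> v; rewrite memv_cap memv_preim => /andP[].
have sfT : (f @: S + T' <= T)%VS.
  by rewrite subv_add sT'T andbT; apply/subvP=> _ /memv_imgP[v /fST ? ->].
have skS : (S :&: lker f <= S :&: f @^-1: T' :&: lker f)%VS.
  apply/subvP=> v; rewrite !memv_cap -memv_preim => /andP[-> kv].
  by move: (kv); rewrite memv_ker => /eqP ->; rewrite mem0v eqxx.
have sfS : (f @: S :&: T' <= f @: (S :&: f @^-1: T'))%VS.
  apply/subvP=> _ /memv_capP[/memv_imgP[v vS ->] fvT'].
  by apply: memv_img; rewrite memv_cap vS -memv_preim.
move: (dimvS sfT) (dimvS skS) (dimvS sfS) (dimv_sum_cap (f @: S) T').
move: (limg_ker_dim f S) (limg_ker_dim f (S :&: f @^-1: T')).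
lia.
Qed.

Lemma dim_capv_ge {F : fieldType} {V : vectType F} {S T U : {vspace V}} :
  (S <= U)%VS -> (T <= U)%VS ->
  (\dim S + \dim T <= \dim (S :&: T) + \dim U)%N.
Proof.
move=> sSU sTU; have := dimv_sum_cap S T.
have /dimvS : (S + T <= U)%VS by rewrite subv_add sSU.
lia.
Qed.

(** * Linear choices of components, and the defect of independence *)

Definition splits {F : fieldType} {V : vectType F} (A B C : {vspace V})
    (f g h : 'End(V)) :=
  [/\ forall v, f v \in A, forall v, g v \in B, forall v, h v \in C
    & forall v, v \in (A + B + C)%VS -> f v + g v + h v = v].

(** The sum need not be direct: the projections make one linear choice of components, and [splits]
    asks for no uniqueness. *)
Lemma splits_exists {F : fieldType} {V : vectType F} (A B C : {vspace V}) :
  exists f g h : 'End(V), splits A B C f g h.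
Proof.
exists (addv_pi1 A B \o addv_pi1 (A + B) C)%VF.
exists (addv_pi2 A B \o addv_pi1 (A + B) C)%VF.
exists (addv_pi2 (A + B) C).
split=> v; first by rewrite comp_lfunE; apply: memv_pi1.
- by rewrite comp_lfunE; apply: memv_pi2.
- exact: memv_pi2.
move=> vABC; rewrite !comp_lfunE addv_pi1_pi2; last exact: memv_pi1.
exact: addv_pi1_pi2.
Qed.

Lemma splitsCA {F : fieldType} {V : vectType F} {A B C : {vspace V}}
    {f g h : 'End(V)} :
  splits A B C f g h -> splits B A C g f h.
Proof.
by case=> fA gB hC E; split=> // v; rewrite (addvC B) (addrC (g v)); apply: E.
Qed.

Lemma splitsAC {F : fieldType} {V : vectType F} {A B C : {vspace V}}
    {f g h : 'End(V)} :
  splits A B C f g h -> splits A C B f h g.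
Proof.
case=> fA gB hC E; split=> // v.
by rewrite -addvA (addvC C) addvA addrAC; apply: E.
Qed.

(** Since the sum vanishes, [a] maps into [A :&: (B + C + D)]; on its kernel [b] maps into
    [B :&: (C + D)], and then [c] into [C :&: D]. The dimensions of these three intersections add up
    to the defect of independence. *)
Lemma sum4_eq0 {F : fieldType} {V : vectType F} (S A B C D : {vspace V})
    (a b c d : 'End(V)) :
    (forall v, v \in S -> [/\ a v \in A, b v \in B, c v \in C & d v \in D]) ->
    (forall v, v \in S -> a v + b v + c v + d v = 0) ->
  exists2 S' : {vspace V}, forall v, v \in S' ->
                [/\ v \in S, a v = 0, b v = 0, c v = 0 & d v = 0]
            & (\dim S + \dim (A + B + C + D)
                 <= \dim S' + (\dim A + \dim B + \dim C + \dim D))%N.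
Proof.
move=> abcd sum0.
have [v /[dup] /abcd[aA bB cC dD] /sum0 s0|S1 S1P dim1] :=
    cut_preimage a S (sub0v (A :&: (B + C + D))).
  rewrite memv_cap aA -memvN.
  have -> : - a v = b v + c v + d v.
    by apply/esym/eqP; rewrite -subr_eq0 opprK addrC !addrA s0.
  by rewrite !memv_add.
have sum1 v : v \in S1 -> v \in S /\ a v = 0.
  by move=> /S1P[-> /[!memv0]/eqP].
have [v /sum1[/[dup] /abcd[aA bB cC dD] /sum0 s0 av0]|S2 S2P dim2] :=
    cut_preimage b S1 (sub0v (B :&: (C + D))).
  rewrite memv_cap bB -memvN.
  have -> : - b v = c v + d v.
    apply/esym/eqP; rewrite -subr_eq0 opprK addrC addrA.
    by move: s0; rewrite av0 add0r => ->.
  by rewrite memv_add.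
have sum2 v : v \in S2 -> [/\ v \in S, a v = 0 & b v = 0].
  by move=> /S2P[/sum1[-> ->] /[!memv0]/eqP].
have [v /sum2[/[dup] /abcd[aA bB cC dD] /sum0 s0 av0 bv0]|S3 S3P dim3] :=
    cut_preimage c S2 (sub0v (C :&: D)).
  rewrite memv_cap cC -memvN.
  suff -> : - c v = d v by [].
  apply/esym/eqP; rewrite -subr_eq0 opprK addrC.
  by move: s0; rewrite av0 bv0 !add0r => ->.
exists S3.
  move=> v /S3P[/sum2[vS av0 bv0] /[!memv0]/eqP cv0]; split=> //.
  by move: (sum0 v vS); rewrite av0 bv0 cv0 !add0r.
move: dim1 dim2 dim3; rewrite !dimv0.
have := dimv_sum_cap A (B + C + D).
have := dimv_sum_cap B (C + D).
have := dimv_sum_cap C D.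
rewrite !addvA; lia.
Qed.

(** * Component relations forced by the spanning conditions, and their cost *)

Lemma Hcond_cap {F : fieldType} {V : vectType F} (S T : {vspace V}) :
  Hcond S T = H S - H (S :&: T)%VS.
Proof. by rewrite /Hcond /H; have := dimv_sum_cap S T; lia. Qed.


(* P and Q carry the components L, M, K and L, M, T: comparing components in
   T <= K + P + Q yields a partial map p from Q to P reversing the common
   components L and M, defined on the image Q1 of a large part of T. *)
Lemma exchange {F : fieldType} {V : vectType F} (K L M T P Q : {vspace V})
    {pK pL pM qL qM qT : 'End(V)} :
    splits K L M pK pL pM -> splits L M T qL qM qT ->
  exists (Q1 : {vspace V}) (p : 'End(V)),
    [/\ (Q1 <= Q)%VS,
        forall v, p v \in P,
        forall v, v \in Q1 ->
          [/\ pL (p v) = - qL v, pM (p v) = - qM v & qT v = 0 -> v = 0]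
      & H T <= H Q1 + Hcond T (K + P + Q)%VS
               + Hcond P (K + L + M)%VS + Hcond Q (L + M + T)%VS
               + (H K + H L + H M + H T - H (K + L + M + T)%VS)].
Proof.
move=> [pKK pLL pMM pE] [qLL qMM qTT qE].
have [k [p [q [kK pP qQ kpq]]]] := splits_exists K P Q.
have [//|T1 T1P dim1] :=
  cut_preimage p (T :&: (K + P + Q))%VS (capvSl P (K + L + M)).
have [//|T2 T2P dim2] := cut_preimage q T1 (capvSl Q (L + M + T)).
have TT2 v : v \in T2 ->
    [/\ v \in T, k v + p v + q v = v, p v \in (P :&: (K + L + M))%VS
      & q v \in (Q :&: (L + M + T))%VS].
  by move=> /T2P[/T1P[/memv_capP[vT vKPQ] pv] qv]; split=> //; apply: kpq.
(* The four maps are the [K]-, [L]-, [M]- and [T]-components of [k v + p v + q v - v], which is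
   zero. *)
have [v /TT2[vT _ _ _]|v /TT2[_ kpqv pv qv]|T3 T3P dim3] :=
  sum4_eq0 T2 K L M T (k + (pK \o p))%VF
    ((pL \o p) + (qL \o q))%VF ((pM \o p) + (qM \o q))%VF ((qT \o q) - \1)%VF.
- by rewrite !(add_lfunE, opp_lfunE, comp_lfunE, id_lfunE) !memvD // memvN.
- rewrite !(add_lfunE, opp_lfunE, comp_lfunE, id_lfunE).
  move: pv qv => /memv_capP[_ /pE pv] /memv_capP[_ /qE qv].
  rewrite !addrA [LHS](ACl (1*2*3*5*4*6*7*8)%AC) /=.
  apply/eqP; rewrite subr_eq0 -!addrA (addrA (pK _)) (addrA (pK _ + _)) pv.
  by rewrite (addrA (qL _)) qv addrA kpqv.
have T3E v : v \in T3 -> [/\ q v \in Q, pL (p v) = - qL (q v),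
    pM (p v) = - qM (q v) & qT (q v) = v].
  move=> /T3P[]; rewrite !(add_lfunE, opp_lfunE, comp_lfunE, id_lfunE).
  move=> _ _ /eqP; rewrite addr_eq0 => /eqP eL.
  by move=> /eqP; rewrite addr_eq0 => /eqP eM /subr0_eq.
(* On [T3] the map [qT] inverts [q], so [p \o qT] sends [q v] to [p v]. *)
exists (q @: T3)%VS, (p \o qT)%VF; split.
- by apply/subvP=> _ /memv_imgP[v /T3E[? _ _ _] ->].
- by move=> v; rewrite comp_lfunE.
- move=> _ /memv_imgP[v /T3E[_ eL eM eT] ->].
  by rewrite comp_lfunE /= eT; split=> // ->; rewrite linear0.
have dimq : \dim (q @: T3) = \dim T3.
  by apply: dim_limg_inj => v /T3E[_ _ _ vE] qv0; rewrite -vE qv0 linear0.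
rewrite !Hcond_cap /H dimq; lia.
Qed.

(** The equations compare components in [v = w v + x v + y v + z v]. The summands are chosen
    linearly in [v], so that [cut_preimage] applies to them. *)
Lemma circuit4 {F : fieldType} {V : vectType F} (A B C D W X Y Z : {vspace V})
    {wB wC wD xA xC xD yA yB yD zA zB zC : 'End(V)} :
    splits B C D wB wC wD -> splits A C D xA xC xD ->
    splits A B D yA yB yD -> splits A B C zA zB zC ->
  exists (A1 : {vspace V}) (w x y z : 'End(V)),
    [/\ [/\ forall v, w v \in W, forall v, x v \in X,
            forall v, y v \in Y & forall v, z v \in Z],
        forall v, v \in A1 ->
          [/\ xA (x v) + yA (y v) + zA (z v) = v,
              wB (w v) + yB (y v) + zB (z v) = 0,
              wC (w v) + xC (x v) + zC (z v) = 0
            & wD (w v) + xD (x v) + yD (y v) = 0]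
      & H A <= H A1 + Hcond A (W + X + Y + Z)%VS
               + Hcond W (B + C + D)%VS + Hcond X (A + C + D)%VS
               + Hcond Y (A + B + D)%VS + Hcond Z (A + B + C)%VS
               + (H A + H B + H C + H D - H (A + B + C + D)%VS)].
Proof.
move=> [wBB wCC wDD wE] [xAA xCC xDD xE] [yAA yBB yDD yE] [zAA zBB zCC zE].
have [f [y [z [fWX yY zZ fyz]]]] := splits_exists (W + X)%VS Y Z.
pose w := (addv_pi1 W X \o f)%VF; pose x := (addv_pi2 W X \o f)%VF.
have wW v : w v \in W by rewrite comp_lfunE; apply: memv_pi1.
have xX v : x v \in X by rewrite comp_lfunE; apply: memv_pi2.
have wxyz v : v \in (W + X + Y + Z)%VS -> w v + x v + y v + z v = v.
  by move=> vS; rewrite -[RHS](fyz v vS) !comp_lfunE addv_pi1_pi2.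
clearbody w x.
have [//|A1 A1P dim1] :=
  cut_preimage w (A :&: (W + X + Y + Z))%VS (capvSl W (B + C + D)).
have [//|A2 A2P dim2] := cut_preimage x A1 (capvSl X (A + C + D)).
have [//|A3 A3P dim3] := cut_preimage y A2 (capvSl Y (A + B + D)).
have [//|A4 A4P dim4] := cut_preimage z A3 (capvSl Z (A + B + C)).
have A4E v : v \in A4 -> [/\ v \in A, w v + x v + y v + z v = v
    & [/\ wB (w v) + wC (w v) + wD (w v) = w v,
          xA (x v) + xC (x v) + xD (x v) = x v,
          yA (y v) + yB (y v) + yD (y v) = y v
        & zA (z v) + zB (z v) + zC (z v) = z v]].
  move=> /A4P[/A3P[/A2P[/A1P[/memv_capP[vA /wxyz vE]]]]].
  move=> /memv_capP[_ /wE ?] /memv_capP[_ /xE ?].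
  by move=> /memv_capP[_ /yE ?] /memv_capP[_ /zE ?].
have [v /A4E[vA _ _]|v /A4E[_ vE [wv xv yv zv]]|A5 A5P dim5] :=
  sum4_eq0 A4 A B C D
    ((xA \o x) + (yA \o y) + (zA \o z) - \1)%VF
    ((wB \o w) + (yB \o y) + (zB \o z))%VF
    ((wC \o w) + (xC \o x) + (zC \o z))%VF
    ((wD \o w) + (xD \o x) + (yD \o y))%VF.
- by rewrite !(add_lfunE, opp_lfunE, comp_lfunE, id_lfunE) !memvD // memvN.
- rewrite !(add_lfunE, opp_lfunE, comp_lfunE, id_lfunE).
  (* The permutation regroups the components by the vector they come from: [w v], [x v], [y v],
     [z v], then [- v]. *)
  rewrite !addrA [LHS](ACl (5*8*11*1*9*12*2*6*13*3*7*10*4)%AC) /=.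
  apply/eqP; rewrite subr_eq0 -[eqbRHS]vE -[in eqbRHS]wv -[in eqbRHS]xv.
  by rewrite -[in eqbRHS]yv -[in eqbRHS]zv !addrA.
exists A5, w, x, y, z; split=> //.
  move=> v /A5P[_]; rewrite !(add_lfunE, opp_lfunE, comp_lfunE, id_lfunE).
  by move=> /subr0_eq.
rewrite !Hcond_cap /H; lia.
Qed.

(** * Chaining the relations in characteristic 3 *)

Theorem theorem4p1 (F : finFieldType) (hchar : 3%N \in [pchar F])
    (V : vectType F) (A B C D W X Y Z : {vspace V}) :
  H A <=
    9 * H Z + 8 * H Y + 5 * H X + 6 * H W
    - 4 * H D - 12 * H C - 11 * H B - H A
    + 19 * Hcond Z (A + B + C)%VS + 17 * Hcond Y (A + B + D)%VS
    + 13 * Hcond X (A + C + D)%VS + 11 * Hcond W (B + C + D)%VS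
    + Hcond A (W + X + Y + Z)%VS + Hcond A (B + W + X)%VS
    + 7 * Hcond B (D + X + Z)%VS + 4 * Hcond B (C + X + Y)%VS
    + 7 * Hcond C (D + Y + Z)%VS + 5 * Hcond C (A + W + Y)%VS
    + 4 * Hcond D (A + W + Z)%VS
    + 29 * (H A + H B + H C + H D - H (A + B + C + D)%VS).
Proof.
have char3 (v : V) : v + v + v = 0.
  by rewrite -mulr2n -mulrSr -scaler_nat (pcharf0 hchar) scale0r.
have [wB [wC [wD wS]]] := splits_exists B C D.
have [xA [xC [xD xS]]] := splits_exists A C D.
have [yA [yB [yD yS]]] := splits_exists A B D.
have [zA [zB [zC zS]]] := splits_exists A B C.
have [X1 [s [sX1 sW X1E dX1]]] :=
  exchange B C D A W X wS (splitsAC (splitsCA xS)).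
have [Z1 [t [sZ1 tX Z1E dZ1]]] :=
  exchange D A C B X Z (splitsCA (splitsAC xS)) (splitsAC zS).
have [Y1 [m [sY1 mX Y1E dY1]]] :=
  exchange C A D B X Y (splitsCA xS) (splitsAC yS).
have [Z2 [r [sZ2 rY Z2E dZ2]]] :=
  exchange D A B C Y Z (splitsCA (splitsAC yS)) zS.
have [W1 [p [sW1 pY W1E dW1]]] := exchange A B D C Y W yS (splitsAC wS).
have [W2 [k [sW2 kZ W2E dW2]]] := exchange A B C D Z W zS wS.
have [A1 [w [x [y [z [[wW xX yY zZ] A1E dA1]]]]]] :=
  circuit4 A B C D W X Y Z wS xS yS zS.
(* Injectivity of the [D]-component holds on [W2]; it is carried by [p] from [W3] to [Y2], and by
   [m] from [Y3] to [X3]. *)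
pose W3 := (W1 :&: W2)%VS; pose Z3 := (Z1 :&: Z2)%VS.
have W3E v : v \in W3 -> yD (p v) = 0 -> v = 0.
  move=> /memv_capP[/W1E[_ -> _] /W2E[_ _ wD0]] /eqP.
  by rewrite oppr_eq0 => /eqP.
pose Y2 := (p @: W3)%VS.
have sY2 : (Y2 <= Y)%VS by apply/subvP=> _ /memv_imgP[v _ ->].
have dY2 : \dim Y2 = \dim W3.
  by apply: dim_limg_inj => v /W3E vE pv0; apply: vE; rewrite pv0 linear0.
have Y2E v : v \in Y2 -> yD v = 0 -> v = 0.
  by move=> /memv_imgP[u /W3E uE ->] /uE ->; rewrite linear0.
pose Y3 := (Y1 :&: Y2)%VS.
have Y3E v : v \in Y3 -> xD (m v) = 0 -> v = 0.
  move=> /memv_capP[/Y1E[_ -> _] /Y2E yD0] /eqP.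
  by rewrite oppr_eq0 => /eqP.
pose X3 := (m @: Y3)%VS.
have sX3 : (X3 <= X)%VS by apply/subvP=> _ /memv_imgP[v _ ->].
have dX3 : \dim X3 = \dim Y3.
  by apply: dim_limg_inj => v /Y3E vE mv0; apply: vE; rewrite mv0 linear0.
have X3E v : v \in X3 -> xD v = 0 -> v = 0.
  by move=> /memv_imgP[u /Y3E uE ->] /uE ->; rewrite linear0.
(* Both [zB] and [zC] are injective on [Z3], so [r] and [t] embed it in [Y] and [X]. These bounds
   serve only the final count. *)
have dZ3Y : (\dim Z3 <= \dim Y)%N.
  rewrite -(@dim_limg_inj _ _ _ r Z3).
    by apply/dimvS/subvP=> _ /memv_imgP[v _ ->].
  move=> v /memv_capP[/Z1E[_ _ zB0] /Z2E[_ zBE _]] rv0; apply: zB0.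
  by apply/eqP; rewrite -oppr_eq0 -zBE rv0 linear0.
have dZ3X : (\dim Z3 <= \dim X)%N.
  rewrite -(@dim_limg_inj _ _ _ t Z3).
    by apply/dimvS/subvP=> _ /memv_imgP[v _ ->].
  move=> v /memv_capP[/Z1E[_ zCE _] /Z2E[_ _ zC0]] rv0; apply: zC0.
  by apply/eqP; rewrite -oppr_eq0 -zCE rv0 linear0.
have dW3 : (\dim W1 + \dim W2 <= \dim W3 + \dim W)%N :=
  dim_capv_ge sW1 sW2.
have dZ3 : (\dim Z1 + \dim Z2 <= \dim Z3 + \dim Z)%N :=
  dim_capv_ge sZ1 sZ2.
have dY3 : (\dim Y1 + \dim Y2 <= \dim Y3 + \dim Y)%N :=
  dim_capv_ge sY1 sY2.
(* When the conditional terms vanish and A, B, C, D are independent, s, k, p, r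
   and m all act as -1, up to identifying the spaces; the cuts are exactly what
   the equalities proved in S11_0 require. *)
have [u uE] : exists u : 'End(V), forall v, u v = w v - s (x v).
  by exists (w - (s \o x))%VF => v; rewrite !(add_lfunE, opp_lfunE, comp_lfunE).
have uW v : u v \in W by rewrite uE memvB.
have [//|S1 S1P d1] := cut_preimage x A1 sX1.
have [//|S2 S2P d2] := cut_preimage u S1 sW2.
have [v|S3 S3P d3] := cut_preimage (z - (k \o u))%VF S2 sZ2.
  by rewrite !(add_lfunE, opp_lfunE, comp_lfunE) memvB.
have [//|S4 S4P d4] := cut_preimage u S3 sW1.
have [v|S5 S5P d5] := cut_preimage (y - (p \o u))%VF S4 sY2.
  by rewrite !(add_lfunE, opp_lfunE, comp_lfunE) memvB.
have [//|S6 S6P d6] := cut_preimage z S5 sZ2.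
have [v|S7 S7P d7] := cut_preimage (y + (r \o z))%VF S6 sY1.
  by rewrite !(add_lfunE, comp_lfunE) memvD.
have [v|S8 S8P d8] := cut_preimage (w + u)%VF S7 sW1.
  by rewrite add_lfunE memvD.
have [v|S9 S9P d9] := cut_preimage (p \o (w + u))%VF S8 sY1.
  by rewrite comp_lfunE.
have [//|S10 S10P d10] := cut_preimage y S9 sY1.
have [v|S11 S11P d11] := cut_preimage (x + (m \o y))%VF S10 sX3.
  by rewrite !(add_lfunE, comp_lfunE) memvD.
have S11_0 : \dim S11 = 0%N.
  suff -> : S11 = 0%VS by rewrite dimv0.
  apply/eqP; rewrite -subv0; apply/subvP=> v.
  move=> /S11P[/S10P[/S9P[/S8P[/S7P[/S6P[/S5P[/S4P[/S3P[/S2P[/S1P[]]]]]]]]]]].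
  rewrite !(add_lfunE, opp_lfunE, comp_lfunE).
  move: (uE v) => /= uvE /A1E[eA eB eC eD] xX1 uW2 zkZ2 uW1 ypY2 zZ2 yrY1.
  move=> wuW1 pY1 yY1 xmX3.
  have [wCs wDs _] := X1E _ xX1.
  (* With [eC] and [eD], the vector [u v] has [C]-component [- zC (z v)] and [D]-component
     [- yD (y v)]; hence [z v = k (u v)] and [y v = p (u v)]. *)
  have wCu : wC (u v) = wC (w v) + xC (x v) by rewrite uvE linearB /= wCs opprK.
  have wDu : wD (u v) = wD (w v) + xD (x v) by rewrite uvE linearB /= wDs opprK.
  have [zBk zCk _] := W2E _ uW2; have [yBp yDp _] := W1E _ uW1.
  have zk : z v = k (u v).
    have [_ _ zC0] := Z2E _ zkZ2; apply: subr0_eq; apply: zC0.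
    by rewrite linearB /= zCk wCu opprK addrC.
  have yp : y v = p (u v).
    apply: subr0_eq; apply: (Y2E _ ypY2).
    by rewrite linearB /= yDp wDu opprK addrC.
  have yBu : yB (y v) = - wB (u v) by rewrite yp.
  have zBu : zB (z v) = - wB (u v) by rewrite zk.
  have [yAr yBr _] := Z2E _ zZ2.
  have yr : y v = - r (z v).
    have [_ _ yB0] := Y1E _ yrY1; apply/eqP; rewrite -addr_eq0; apply/eqP.
    by apply: yB0; rewrite linearD /= yBr yBu zBu subrr.
  have wBw : wB (w v) = wB (u v) + wB (u v).
    by apply/eqP; rewrite -subr_eq0 opprD addrA -{1}yBu -zBu eB.
  have [yBp' yDp' _] := W1E _ wuW1.
  (* First use of characteristic 3: the [B]-component of [w v + u v] is three times [wB (u v)]. It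
     recurs for the [D]-component of [x v + m (y v)], and for [v] itself. *)
  have p0 : p (w v + u v) = 0.
    have [_ _ yB0] := Y1E _ pY1; apply: yB0.
    by rewrite yBp' linearD /= wBw char3 oppr0.
  have wDw : wD (w v) = - wD (u v).
    apply/eqP; rewrite -addr_eq0 -linearD -oppr_eq0 -yDp' p0.
    by rewrite linear0.
  have xDu : xD (x v) = wD (u v) + wD (u v).
    by rewrite -[LHS](addKr (wD (w v))) -wDu wDw opprK.
  have [xAm xDm _] := Y1E _ yY1.
  have xm : x v = - m (y v).
    apply/eqP; rewrite -addr_eq0; apply/eqP; apply: (X3E _ xmX3).
    by rewrite linearD /= xDm yp yDp opprK xDu char3.
  have xAy : xA (x v) = yA (y v) by rewrite xm linearN /= xAm opprK.
  have yAz : yA (y v) = zA (z v) by rewrite yr linearN /= yAr opprK.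
  by rewrite memv0 -eA xAy yAz char3.
have swap (S T U : {vspace V}) : (S + T + U = S + U + T)%VS.
  by rewrite -!addvA (addvC T).
(* As [S11] is zero, [\dim A1] is at most the sum of the eleven codimensions. The stated
   coefficients come from adding twice [\dim Z1 <= \dim Z], once
   [\dim W1 + \dim W2 <= \dim W + \dim Y] (through [Y2]), and five times [dZ3], bounding [\dim Z3]
   twice by [\dim Y] and three times by [\dim X]. The defect is then counted 1 + 7 + 4 + 7 + 5 + 4
   times for the exchanges and once for [circuit4], in all 29. *)
have sZ1' := dimvS sZ1; have sY2' := dimvS sY2.
move: dX1 dZ1 dY1 dZ2 dW1 dW2 dA1.
(* Sums of the same subspaces must be written identically for [lia] to treat their dimensions as one
   unknown. *)
rewrite !(swap _ B A, swap _ C A, swap _ D A, swap _ C B, swap _ D B,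
  swap _ D C, addvC B A, addvC C A, addvC D A, swap _ Y W, swap _ Z W).
clearbody W3 Z3 Y2 Y3 X3.
clear -d1 d2 d3 d4 d5 d6 d7 d8 d9 d10 d11 S11_0 dZ3Y dZ3X dW3 dZ3 dY3 dX3 dY2
  sZ1' sY2'.
rewrite /Hcond /H; lia.
Qed.
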